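(* Let $P(x) \in \mathbb{Z}[x]$ be a reducible quartic polynomial, i.e. a polynomial of degree exactly $4$ that is a product of two non-constant polynomials with integer coefficients. Then $P(x) \in \mathcal{P}$; that is, there are infinitely many positive integers $n$ such that $P(n) \mid n!$.
   Context: $\mathcal{P}$ denotes the set of polynomials $P(x)$ with integer coefficients such that $P(n) \mid n!$ for infinitely many positive integers $n$ (divisibility in $\mathbb{Z}$). *)

(* Defs.v *)
From mathcomp Require Import all_boot all_order all_algebra.

Set Implicit Arguments.
Unset Strict Implicit.
Unset Printing Implicit Defensive.

Import Order.TTheory GRing.Theory Num.Theory.
Local Open Scope ring_scope.

(* "Infinitely many positive integers n" is rendered
   as: arbitrarily large n (the bound N < n also forces n to be positive).
   Divisibility is in Z, so P.[n] may be negative, and P.[n] = 0 never divides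
   the nonzero integer n`!. *)
Definition factorial_dividing (P : {poly int}) : Prop :=
  forall N : nat, exists n : nat,
    (N < n)%N /\ (P.[n%:Z] %| (n`!)%:Z)%Z.

(* size Q = deg Q + 1.  Both factors must be non-constant: splitting off an
   integer constant such as 2 does not make P reducible here. *)
Definition reducible_intpoly (P : {poly int}) : Prop :=
  exists Q R : {poly int}, [/\ (1 < size Q)%N, (1 < size R)%N & P = Q * R].

(* Main.v *)
Require Import Defs.
From mathcomp Require Import all_boot all_order all_algebra.
From mathcomp Require Import zify ring.

Set Implicit Arguments.
Unset Strict Implicit.
Unset Printing Implicit Defensive.

Import Order.TTheory GRing.Theory Num.Theory.
Local Open Scope ring_scope.

(** A product of positive integers with sum at most n divides n!. So it suffices
    to find a polynomial substitution n = n(t) under which P(n) divides a product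
    of polynomials in t whose degrees do not exceed that of n(t): the constants by
    which the factors may exceed n are disposed of by congruence conditions on t
    ([factorial_dividing_of_split]). For a factor F of P with a root theta, F(n) is
    up to a constant the norm of n - theta, so one wants n(t) - theta to split
    over the field of theta into factors of small degree.

    Two quadratics. After completing squares they are X^2 - d1 and (X - a)^2 - d2.
    Put u + v X = Z^2 with Z = beta - t^2 / 2. Over Q(sqrt d1) the polynomial
    X - sqrt d1 splits if u + v sqrt d1 is a square (x + y sqrt d1)^2. Over
    Q(sqrt d2) put mu = rho + sqrt d2; if u + v (a + sqrt d2) = mu^2 (2 beta - mu^2),
    then 4 v (X - a - sqrt d2) is the product of the two polynomials
    t^2 -+ 2 mu t + 2 mu^2 - 2 beta. The unknowns u, v, beta can be eliminated and
    the conic x^2 + (2 a - rho - d2 / rho) x y + d1 y^2 = (rho^2 - d2)^2 remains. It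
    has the rational point y = 0, hence is parametrized by s = (x - rho^2 + d2) / y;
    the parameter used is s = 1 / (rho om^2). So X has degree 4 in t, and both
    polynomials split into two quartics ([factorial_dividing_of_squares]).

    A linear and a cubic factor. The linear factor has the degree of n. For the
    cubic f = X^3 + p X + q expand around a rational point m, so that y stands for
    theta - m. The cubic algebra contains an element delta whose square has degree 1 in
    y, and there is an odd cubic polynomial H such that H(delta)^2 has degree 1 in y as
    well (see [cubicQ]). Hence H(T)^2 = c (X - m) + c' defines a substitution X of
    degree 6 in T for which c (X - theta) = (H(T) - H(delta)) (H(T) + H(delta)) is
    divisible by T - delta and T + delta: over the rationals f(X) splits into factors of
    degrees 3, 6, 3, 6 ([cubic_split]).

    In both cases the substitution has rational coefficients, and what remains is
    to find one parameter at which X is an integer in a given residue class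
    ([squares_base_point], [cubic_parameters]). For the cubic this needs roots of f
    modulo f'(m), whence a special choice of m. It presupposes that two numbers
    depending on p and q do not vanish; if one of them does, then f has a rational
    root and P is, up to a constant, a product of two quadratics. *)

(** * Products of small factors divide factorials *)

(** Multinomial coefficients are integers. The sum of the factors is used, and not
    their maximum, because some of them may coincide. *)
Lemma prod_dvd_fact_sum (s : seq nat) :
  all (fun x => 0 < x)%N s -> (\prod_(x <- s) x %| (\sum_(x <- s) x)`!)%N.
Proof.
elim: s => [|x s IHs] /=; first by rewrite !big_nil.
case/andP=> x_gt0 /IHs s_dvd; rewrite !big_cons.
apply: (@dvdn_trans (x`! * (\sum_(y <- s) y)`!)%N).
  by apply: dvdn_mul s_dvd; rewrite dvdn_fact // x_gt0 leqnn.
have /bin_fact := leq_addr (\sum_(y <- s) y) x.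
by rewrite addKn => <-; rewrite dvdn_mull.
Qed.

Lemma horner_partial_sum_le (p : {poly int}) (d : nat) :
  exists2 c : int, 0 <= c &
    forall t : int, 1 <= t -> `|\sum_(i < d.+1) p`_i * t ^+ i| <= c * t ^+ d.
Proof.
exists (\sum_(i < d.+1) `|p`_i|); first exact: sumr_ge0.
move=> t t_ge1; apply: le_trans (ler_norm_sum _ _ _) _.
rewrite mulr_suml; apply: ler_sum => i _.
rewrite normrM ler_wpM2l // normrX ger0_norm ?(le_trans _ t_ge1) //.
by rewrite ler_weXn2l // -ltnS.
Qed.

Lemma horner_le_pow (p : {poly int}) (d : nat) : (size p <= d.+1)%N ->
  exists2 c : int, 0 <= c & forall t : int, 1 <= t -> `|p.[t]| <= c * t ^+ d.
Proof.
move=> size_p; have [c c_ge0 c_bound] := horner_partial_sum_le p d.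
by exists c => // t t_ge1; rewrite (horner_coef_wide _ size_p) c_bound.
Qed.

Lemma pow_le_double_horner (p : {poly int}) :
    (1 < size p)%N -> 0 < lead_coef p ->
  exists T : int, forall t, T <= t -> t ^+ (size p).-1 <= 2 * p.[t].
Proof.
rewrite lead_coefE; case size_p: (size p) => [|[|d]] //= _ lead_gt0.
have [c c_ge0 c_bound] := horner_partial_sum_le p d.
exists (2 * c + 1) => t t_ge.
have t_ge1 : 1 <= t by lia.
have /ler_normlP[rest_ge _] := c_bound t t_ge1.
rewrite horner_coef size_p big_ord_recr /=.
have pow_ge0 : 0 <= t ^+ d by apply: exprn_ge0; lia.
rewrite exprS; set s := \sum_(i < _) _ in rest_ge *; set u := t ^+ d in pow_ge0 rest_ge *.
set l := p`_d.+1 in lead_gt0 *.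
have ge_t : t * u <= l * (t * u).
  by rewrite ler_peMl ?mulr_ge0 //; lia.
have : 2 * c * u <= t * u by rewrite ler_wpM2r //; lia.
lia.
Qed.

Lemma horner_eqmod (p : {poly int}) (x y m : int) :
  (m %| x - y)%Z -> (m %| p.[x] - p.[y])%Z.
Proof.
move=> xy; elim/poly_ind: p => [|p c IHp]; first by rewrite !horner0 subrr dvdz0.
rewrite !hornerMXaddC.
have -> : p.[x] * x + c - (p.[y] * y + c) = (p.[x] - p.[y]) * x + p.[y] * (x - y).
  by ring.
by apply: rpredD; [apply: dvdz_mulr | apply: dvdz_mull].
Qed.

(** K is uniform over As: it decides how large the fixed divisors in the next
    lemma have to be. *)
Lemma eventually_bounds (g : {poly int}) (As : seq {poly int}) :
    (1 < size g)%N -> 0 < lead_coef g ->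
    all (fun A : {poly int} => 1 < size A <= size g)%N As ->
  exists K T : int, [/\ 1 <= K, 1 <= T & forall t, T <= t -> t <= 2 * g.[t] /\
    forall A, A \in As -> t <= 2 * `|A.[t]| /\ `|A.[t]| <= K * g.[t]].
Proof.
move=> size_g lead_g.
have pow_ge (d : nat) (t : int) : 1 <= t -> (0 < d)%N -> t <= t ^+ d.
  by move=> t_ge1 d_gt0; rewrite -[leLHS]expr1 ler_weXn2l.
have [T1 lower_g] := pow_le_double_horner size_g lead_g.
have size_gE : (0 < (size g).-1)%N by lia.
elim: As => [|A As IHs] /=.
  move=> _; exists 1, (Num.max 1 T1); split; rewrite ?le_max ?lexx // => t.
  rewrite ge_max => /andP[t_ge1 t_ge]; split=> //.
  exact: le_trans (pow_ge _ _ t_ge1 size_gE) (lower_g _ t_ge).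
case/andP=> /andP[size_A le_A] /IHs[K [T [K_ge1 T_ge1 IH]]].
have size_A' : (size A <= (size g).-1.+1)%N by rewrite prednK // ltnW.
have [c c_ge0 upper_A] := horner_le_pow size_A'.
have [T2 lower_A] : exists T2 : int, forall t, T2 <= t ->
    t ^+ (size A).-1 <= 2 * `|A.[t]|.
  have A_neq0 : lead_coef A != 0 by rewrite lead_coef_eq0 -size_poly_gt0 ltnW.
  have [lead_gt0|lead_le0] := ltP 0 (lead_coef A).
    have [T2 T2P] := pow_le_double_horner size_A lead_gt0.
    by exists T2 => t /T2P le_t; rewrite (le_trans le_t) // ler_pM2l // ler_norm.
  have size_NA : (1 < size (- A))%N by rewrite size_polyN.
  have lead_NA : 0 < lead_coef (- A) by rewrite lead_coefN oppr_gt0 lt_neqAle A_neq0.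
  have [T2 T2P] := pow_le_double_horner size_NA lead_NA.
  exists T2 => t /T2P; rewrite size_polyN hornerN => le_t.
  by rewrite (le_trans le_t) // ler_pM2l // -normrN ler_norm.
exists (Num.max K (2 * c)), (Num.max (Num.max T T1) T2).
split; rewrite ?le_max ?K_ge1 ?T_ge1 // => t.
rewrite !ge_max -andbA => /and3P[t_T t_T1 t_T2]; have [g_ge AsP] := IH t t_T.
have t_ge1 : 1 <= t by apply: le_trans T_ge1 _.
have g_ge0 : 0 <= g.[t] by lia.
split=> // B; rewrite inE => /predU1P[->|/AsP[B_ge B_le]].
  split.
    by rewrite (le_trans _ (lower_A t t_T2)) // pow_ge // -ltnS prednK // ltnW.
  apply: le_trans (upper_A t t_ge1) _.
  apply: (@le_trans _ _ ((2 * c) * g.[t])); last first.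
    by rewrite ler_wpM2r // le_max lexx orbT.
  by rewrite [2 * c]mulrC -mulrA ler_wpM2l // lower_g.
split=> //; apply: le_trans B_le _.
by rewrite ler_wpM2r // le_max lexx.
Qed.

(** A factor A has at most the degree of n = g / den, but it may exceed n by a
    constant factor. The remedy is a point t1 at which all d_A = |A(t1)| are
    large. If t = t1 modulo the product of the d_A, then A(t) is the product of
    d_A, which stays bounded, and of A(t) / d_A, which is small compared with n;
    for t large all these numbers sum up to at most n. The progression t0 + L j
    stands for the parameters at which n is an integer. *)
Lemma factorial_dividing_of_split (P g : {poly int}) (As : seq {poly int})
    (den t0 L : int) :
    0 < den -> 0 < L -> (1 < size g)%N -> 0 < lead_coef g ->
    all (fun A : {poly int} => 1 < size A <= size g)%N As ->
    (forall j : int, exists2 n : int, den * n = g.[t0 + L * j] &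
       (P.[n] %| \prod_(A <- As) A.[t0 + L * j])%Z) ->
  factorial_dividing P.
Proof.
move=> den_gt0 L_gt0 size_g lead_g size_As splitP N.
have [K [T [K_ge1 T_ge1 bounds]]] := eventually_bounds size_g lead_g size_As.
(* The fixed divisors d_A have to exceed 2 r K den, so that r of the quotients
   A(t) / d_A, each at most K den n / d_A, take up at most half of n. *)
pose r : int := (size As)%:Z.
have r_ge0 : 0 <= r by [].
pose S := T + 4 * r * K * den.
have KD_ge0 : 0 <= 4 * r * K * den by rewrite !mulr_ge0 //; lia.
pose j1 := `|S| + `|t0|; pose t1 := t0 + L * j1.
have t1_ge : S <= t1.
  have : 1 * j1 <= L * j1 by rewrite ler_wpM2r //; rewrite /j1; lia.
  by rewrite /t1 /j1; lia.
have [_ A1] := bounds t1 ltac:(lia).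
have A1_neq0 A : A \in As -> A.[t1] != 0 by case/A1; lia.
pose Dp := \prod_(A <- As) A.[t1].
have Dp_neq0 : Dp != 0 by rewrite /Dp big_seq; elim/big_ind: _ => // x y; apply: mulf_neq0.
have A1_dvd A : A \in As -> (A.[t1] %| Dp)%Z.
  by move=> A_in; rewrite /Dp (big_rem A) //= dvdz_mulr.
(* Going E steps further makes n exceed N and leaves the other half of n to
   the d_A, each of which is at most the absolute value of Dp. *)
pose E := 2 * den * (2 * r * `|Dp| + N%:Z + 1).
have E_ge0 : 0 <= E.
  by rewrite !mulr_ge0 ?addr_ge0 ?mulr_ge0 //; lia.
pose j := j1 + `|Dp| * E; pose t := t0 + L * j.
have [n den_n n_dvd] := splitP j; rewrite -/t in den_n n_dvd.
have LD_ge1 : 1 <= L * `|Dp| by rewrite -[1]mulr1 ler_pM //; lia.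
have t_E : t1 + E <= t.
  rewrite /t /j mulrDr addrA -/t1 lerD2l mulrA.
  by rewrite ler_peMl.
have t_gt0 : 0 < t by lia.
have [g_ge At] := bounds t ltac:(lia).
have n_ge : 2 * r * `|Dp| + N%:Z + 1 <= n.
  have : den * (2 * (2 * r * `|Dp| + N%:Z + 1)) <= den * (2 * n).
    move: t_E g_ge; rewrite -den_n /E; lia.
  by rewrite ler_pM2l //; lia.
have rD_ge0 : 0 <= 2 * r * `|Dp| by rewrite !mulr_ge0.
exists `|n|%N; split; first by lia.
have -> : `|n|%N%:Z = n :> int by lia.
apply: dvdz_trans n_dvd _.
have At_dvd A : A \in As -> (A.[t1] %| A.[t])%Z.
  move=> A_in; rewrite -[A.[t]](subrK A.[t1]); apply: rpredD => //.
  apply: horner_eqmod; have -> : t - t1 = L * (`|Dp| * E) by rewrite /t /t1 /j; ring.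
  by apply/dvdz_mull/dvdz_mulr; rewrite normrEsign dvdz_mull // A1_dvd.
pose d A := `|A.[t1]|%N; pose q A := (`|A.[t]| %/ d A)%N.
have dqE A : A \in As -> (d A * q A = `|A.[t]|)%N.
  by move=> A_in; rewrite mulnC divnK // -dvdzE At_dvd.
have d_gt0 A : A \in As -> (0 < d A)%N by rewrite absz_gt0 => /A1_neq0.
have q_gt0 A : A \in As -> (0 < q A)%N.
  move=> A_in; have [At_ge _] := At A A_in.
  have At_neq0 : A.[t] != 0.
    by apply: contraTneq At_ge => ->; rewrite normr0 mulr0 -ltNge.
  have := dqE A A_in; case: (q A) => //.
  by rewrite muln0 => /esym/eqP; rewrite absz_eq0 (negPf At_neq0).
have d_le A : A \in As -> (2 * size As * d A <= `|n|)%N.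
  move=> A_in; have /dvdzP[w Dp_eq] := A1_dvd A A_in.
  have d_le_Dp : (d A <= `|Dp|)%N.
    by apply: dvdn_leq; rewrite ?absz_gt0 // -dvdzE A1_dvd.
  have : (2 * size As * d A <= 2 * size As * `|Dp|)%N by rewrite leq_mul2l d_le_Dp orbT.
  rewrite /r in n_ge rD_ge0; lia.
have q_le A : A \in As -> (2 * size As * q A <= `|n|)%N.
  move=> A_in; have [_ At_le] := At A A_in; have [A1_ge _] := A1 A A_in.
  have KD_gt0 : 0 < K * den by rewrite mulr_gt0 //; lia.
  have d_ge : 2 * r * (K * den) <= (d A)%:Z.
    rewrite /d abszE -(@ler_pM2l _ 2) // (le_trans _ A1_ge) // (le_trans _ t1_ge) // /S.
    have -> : 2 * (2 * r * (K * den)) = 4 * r * K * den by ring.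
    by rewrite lerDr; lia.
  have : (2 * r * (K * den)) * (q A)%:Z <= (K * den) * n.
    apply: (@le_trans _ _ ((d A)%:Z * (q A)%:Z)); first exact: ler_wpM2r.
    by rewrite -PoszM dqE // abszE -mulrA den_n.
  have -> : 2 * r * (K * den) * (q A)%:Z = (K * den) * (2 * r * (q A)%:Z) by ring.
  by rewrite ler_pM2l // /r; lia.
pose s := [seq d A | A <- As] ++ [seq q A | A <- As].
have s_gt0 : all (fun x => 0 < x)%N s.
  by rewrite all_cat !all_map; apply/andP; split; apply/allP => A;
    [apply: d_gt0 | apply: q_gt0].
have prod_s : (\prod_(x <- s) x = `|(\prod_(A <- As) A.[t])%R|)%N.
  rewrite big_cat /= !big_map -big_split /= (big_morph absz abszM (erefl _)).
  by rewrite !big_seq; apply: eq_bigr => A /dqE.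
have sum_s : (\sum_(x <- s) x <= `|n|)%N.
  rewrite big_cat /= !big_map -big_split /=.
  case As_nil: (size As) => [|k]; first by rewrite (size0nil As_nil) big_nil.
  rewrite -(@leq_pmul2l (2 * size As)) ?As_nil // -As_nil big_distrr /=.
  apply: (@leq_trans (\sum_(A <- As) (2 * `|n|))%N).
    rewrite !big_seq; apply: leq_sum => A A_in.
    by have := d_le A A_in; have := q_le A A_in; lia.
  by rewrite big_const_seq count_predT iter_addn_0; lia.
rewrite dvdzE -prod_s absz_nat.
apply: dvdn_trans (prod_dvd_fact_sum s_gt0) _.
by rewrite -(bin_fact sum_s) dvdn_mull // dvdn_mulr.
Qed.

Lemma factorial_dividing_dvd (P Q : {poly int}) :
  (forall n, (P.[n] %| Q.[n])%Z) -> factorial_dividing Q -> factorial_dividing P.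
Proof.
move=> PQ fdQ N; have [n [n_gt n_dvd]] := fdQ N.
by exists n; split=> //; apply: dvdz_trans n_dvd.
Qed.

Lemma size_Poly_last (s : seq int) : last 1 s != 0 -> size (Poly s) = size s.
Proof. by move=> s_last; rewrite (PolyK s_last). Qed.

Lemma associate_lead_gt0 (Q : {poly int}) : Q != 0 -> exists Q' : {poly int},
  [/\ size Q' = size Q, 0 < lead_coef Q' & forall n, (Q.[n] %| Q'.[n])%Z].
Proof.
rewrite -lead_coef_eq0 => lead_neq0; case: (ltP 0 (lead_coef Q)) => lead.
  by exists Q; split.
exists (- Q); rewrite size_polyN lead_coefN oppr_gt0 lt_neqAle lead_neq0; split=> // n.
by rewrite hornerN rpredN.
Qed.

(** * Coprimality and congruences of integers *)

(** Used with k a resultant: a common prime of m and n divides k. *)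
Lemma coprimez_combo (m n k u v : int) :
  coprimez m k -> k = u * m + v * n -> coprimez m n.
Proof.
move=> /coprimezP[[x y] /= xy] kE; apply/coprimezP; exists (x + y * u, y * v) => /=.
by rewrite -xy kE; ring.
Qed.

Lemma coprimez_1mod (m n u : int) : n = 1 + m * u -> coprimez n m.
Proof.
by move=> ->; apply/coprimezP; exists (1, - u) => /=; ring.
Qed.

Lemma coprimez_dvd (m n k : int) : (k %| n)%Z -> coprimez m n -> coprimez m k.
Proof. by case/dvdzP=> w ->; rewrite coprimezMr => /andP[]. Qed.

Lemma linear_congruence (m u v : int) : coprimez m u ->
  exists z : int, (m %| u * z - v)%Z.
Proof.
case/coprimezP=> [[x y] /= xy]; exists (y * v); apply/dvdzP; exists (- x * v).
have -> : u * (y * v) - v = (y * u - 1) * v by ring.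
by rewrite -xy; ring.
Qed.

Lemma crt (m1 m2 z1 z2 : int) : coprimez m1 m2 ->
  exists z : int, (m1 %| z - z1)%Z /\ (m2 %| z - z2)%Z.
Proof.
rewrite coprimez_sym => co; have [w m2_w] := linear_congruence (z2 - z1) co.
exists (z1 + m1 * w); split; first by rewrite addrAC subrr add0r dvdz_mulr.
by have -> : z1 + m1 * w - z2 = m1 * w - (z2 - z1) by ring.
Qed.

Lemma sqr_ge1 (x : int) : x != 0 -> 1 <= x ^+ 2.
Proof. by move=> x_neq0; rewrite -gtz0_ge1 exprn_even_gt0. Qed.

(** * Two quadratic factors *)

(** rho is prescribed modulo M only, so it may have any sign and be large.
    The sign conditions make the leading coefficient of X positive, and
    k^2 - 4 d1 rho^2 is a modulus in what follows, hence must not vanish. *)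
Lemma large_parameter (d1 d2 a X0 M : int) : 0 < M ->
  exists rho h : int, [/\ rho = a - X0 - M * h, rho ^+ 2 - d2 != 0,
    2 * a * rho - rho ^+ 2 - d2 < 0,
    (2 * a * rho - rho ^+ 2 - d2) ^+ 2 - 4 * d1 * rho ^+ 2 != 0 &
    if 0 < d1 then 0 < rho else rho < 0].
Proof.
move=> M_gt0.
pose s : int := if 0 < d1 then 1 else -1.
pose B := `|a| + `|X0| + `|d1| + `|d2| + 2.
pose H := 5 * B.
exists (a - X0 - M * (- s * H)), (- s * H).
set rho := (X in [/\ X = _ , _, _, _ & _]).
have H_le : H <= M * H by rewrite ler_peMl //; lia.
have rho_ge : 4 * B <= s * rho.
  rewrite /rho; move: H_le; rewrite /s /H; case: ifP => _; lia.
have rho2 : rho ^+ 2 = (s * rho) ^+ 2 by rewrite /s; case: ifP => _; ring.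
have B_ge1 : 1 <= B by lia.
set y := s * rho in rho_ge rho2.
have y_pos : 0 < y by lia.
have y2_ge : 4 * B * y <= y ^+ 2 by rewrite expr2 ler_wpM2r //; lia.
have d2_le : `|d2| < y by lia.
have By_ge : B * 1 <= B * y by rewrite ler_wpM2l //; lia.
have ay : 2 * a * rho <= 2 * (B * y).
  apply: le_trans (ler_norm _) _; rewrite !normrM.
  have -> : `|rho| = y by rewrite /y /s; move: y_pos; rewrite /y /s; case: ifP; lia.
  by rewrite -mulrA ler_wpM2l // ler_wpM2r //; lia.
have k_le : 2 * a * rho - rho ^+ 2 - d2 <= - (B * y) by lia.
split=> //.
- by rewrite rho2; lia.
- lia.
- set k := _ - d2 in k_le *.
  have k2_ge : (B * y) ^+ 2 <= k ^+ 2.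
    by rewrite -[k ^+ 2]sqrrN ler_sqr ?nnegrE; lia.
  have B2_gt : 4 * d1 < B ^+ 2.
    have : (`|d1| + 2) ^+ 2 <= B ^+ 2 by rewrite ler_sqr ?nnegrE; lia.
    have := sqr_ge0 `|d1|; have := ler_norm d1; clear; rewrite !expr2; lia.
  have : 4 * d1 * y ^+ 2 < B ^+ 2 * y ^+ 2 by rewrite ltr_pM2r // exprn_gt0.
  by rewrite rho2 => lt; rewrite subr_eq0 gt_eqF // (lt_le_trans lt) // -exprMn.
- by move: y_pos; rewrite /y /s; case: ifP => _; lia.
Qed.

(** The integral point. At t = 2 rho one has X = a - rho + x y / (8 rho^2), where
    x y = rho P / D^2, which is integral except at the primes of D. There x and
    y have poles, and X is integral as soon as t is close to a square root of
    x y / rho; such a root exists because the parameter 1 / (rho om^2) of the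
    conic is rho times a square. The value t0 / D combines both conditions: it
    is close to 2 rho at the primes of om, nu, N and G, and close to the root at
    those of D, since N c = 1 modulo D. *)
Lemma squares_base_point (d2 a rho mu c1 f N G D : int) :
    let nu := rho ^+ 2 - d2 in let k := 2 * a * rho - rho ^+ 2 - d2 in
    let om := 8 * rho * mu in let c := om ^+ 2 * c1 in
    let P := nu ^+ 2 * om ^+ 2 * N * G in
    let W := P + 2 * (rho ^+ 2 + d2) * D ^+ 2 in
    let t0 := 2 * rho * D + om * nu * N * G * c in
    G = D + N -> N * c = 1 + D * f ->
  exists X1 : int, 8 * rho * P * D ^+ 2 * (a - rho + mu * X1)
    = (t0 ^+ 2 - W) ^+ 2 - 4 * nu ^+ 2 * D ^+ 4 + 4 * k * P * D ^+ 2.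
Proof.
move=> nu k om c P W t0 GE cN.
(* e is the quotient by D of 1 - c^2 N G, which is 1 - (c N)^2 modulo D. *)
pose e := - (2 * f + D * f ^+ 2 + c * (1 + D * f)).
have De : D * e = 1 - c ^+ 2 * N * G.
  have -> : c ^+ 2 * N * G = (N * c) ^+ 2 + c * D * (N * c) by rewrite GE; ring.
  by rewrite cN /e; ring.
pose q := c ^+ 2 * N * G.
(* lam / D is the distance of the parameter t0 / D from 2 rho. *)
pose lam := om * nu * N * G * c.
pose b := om * c1.
exists (om * N * G * (16 * rho ^+ 2 * b ^+ 2 + 4 * nu * b ^+ 2 + nu ^+ 2 * e ^+ 2)
  + 16 * rho * c1 * D - 8 * rho * nu * N * G * c * e).
have lam2 : lam ^+ 2 = P * q by rewrite /lam /P /q; ring.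
have Pb : nu * lam = P * b by rewrite /lam /P /b /c; ring.
have t0W : t0 ^+ 2 - W = 4 * rho * D * lam - P * (D * e) + 2 * nu * D ^+ 2.
  have -> : t0 ^+ 2 = 4 * rho ^+ 2 * D ^+ 2 + 4 * rho * D * lam + lam ^+ 2.
    by rewrite /t0 -/lam; ring.
  by rewrite lam2 De -/q /W /nu; ring.
transitivity (P * (16 * rho ^+ 2 * D ^+ 2 * q + P * (D * e) ^+ 2
    - 8 * rho * D * lam * (D * e) + 16 * rho * D ^+ 3 * b
    - 4 * nu * D ^+ 2 * (D * e) + 4 * k * D ^+ 2)).
  have -> : 4 * k * D ^+ 2 = 4 * nu * D ^+ 2 + 8 * rho * (a - rho) * D ^+ 2.
    by rewrite /k /nu; ring.
  have De1 : 4 * nu * D ^+ 2 * (D * e) = 4 * nu * D ^+ 2 - 4 * nu * D ^+ 2 * q.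
    by rewrite De -/q; ring.
  by rewrite De1 /q /c /lam /P /b /c /om; ring.
have -> : (t0 ^+ 2 - W) ^+ 2 = 16 * rho ^+ 2 * D ^+ 2 * lam ^+ 2
    + P ^+ 2 * (D * e) ^+ 2 + 4 * nu ^+ 2 * D ^+ 4 - 8 * rho * D * lam * P * (D * e)
    + 16 * rho * D ^+ 3 * (nu * lam) - 4 * nu * D ^+ 2 * P * (D * e).
  by rewrite t0W; ring.
by rewrite lam2 Pb; ring.
Qed.

(** The sign of rho N G is the one of the leading coefficient of X. *)
Lemma squares_sign (d1 rho k z om N G : int) :
    z != 0 -> k < 0 -> (if 0 < d1 then 0 < rho else rho < 0) ->
    om = 8 * z -> N = 1 - d1 * rho ^+ 2 * om ^+ 4 -> G = 2 + k * om ^+ 2 ->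
  0 < rho * N * G.
Proof.
move=> z_neq0 k_lt0 rho_sign omE NE GE.
have rho_neq0 : rho != 0 by move: rho_sign; clear; case: ifP => _; lia.
have G_lt0 : G < 0.
  have om2 : om ^+ 2 = 64 * z ^+ 2 by rewrite omE; ring.
  have le1 : - k * 1 <= - k * z ^+ 2 by rewrite ler_wpM2l ?sqr_ge1 //; clear -k_lt0; lia.
  by rewrite GE om2; clear -le1 k_lt0; lia.
have y_ge1 : 16 * 1 <= rho ^+ 2 * om ^+ 4.
  have -> : rho ^+ 2 * om ^+ 4 = 16 * (16 * (rho * z ^+ 2)) ^+ 2 by rewrite omE; ring.
  by rewrite ler_pM2l // sqr_ge1 // !mulf_neq0 // expf_neq0.
rewrite nmulr_lgt0 // NE -mulrA; move: (rho ^+ 2 * om ^+ 4) y_ge1 rho_sign => y y_ge1.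
case: (ltP 0 d1) => [d1_gt0|d1_le0] rho_sign.
  rewrite pmulr_rlt0 // subr_lt0.
  have : 1 * y <= d1 * y by rewrite ler_wpM2r //; clear -y_ge1 d1_gt0; lia.
  by clear -y_ge1; lia.
rewrite nmulr_rlt0 // subr_gt0 (le_lt_trans _ ltr01) //.
by rewrite mulr_le0_ge0 //; clear -y_ge1; lia.
Qed.

(** D is 1 modulo om, while a common prime of D and N divides
    (k^2 - 4 d1 rho^2) om^4. So N is invertible modulo D once om is a multiple
    of k^2 - 4 d1 rho^2. *)
Lemma squares_parameters (d1 d2 a X0 M : int) : 0 < M ->
  exists rho om N G t0 X1 : int,
  let nu := rho ^+ 2 - d2 in let k := 2 * a * rho - rho ^+ 2 - d2 in
  let D := G - N in let P := nu ^+ 2 * om ^+ 2 * N * G in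
  let W := P + 2 * (rho ^+ 2 + d2) * D ^+ 2 in
  [/\ N = 1 - d1 * rho ^+ 2 * om ^+ 4, G = 2 + k * om ^+ 2,
     D != 0, 0 < rho * P &
     8 * rho * P * D ^+ 2 * (X0 + M * X1)
       = (t0 ^+ 2 - W) ^+ 2 - 4 * nu ^+ 2 * D ^+ 4 + 4 * k * P * D ^+ 2].
Proof.
move=> M_gt0.
have [rho [h [rhoE nu_neq0 k_lt0 w_neq0 rho_sign]]] := large_parameter d1 d2 a X0 M_gt0.
set k := 2 * a * rho - rho ^+ 2 - d2 in k_lt0 w_neq0.
set w := k ^+ 2 - 4 * d1 * rho ^+ 2 in w_neq0.
set nu := rho ^+ 2 - d2 in nu_neq0.
have rho_neq0 : rho != 0 by move: rho_sign; clear; case: ifP => _; lia.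
(* M keeps X in its residue class, w makes D and N coprime. *)
pose mu := M * w; pose om := 8 * rho * mu.
have rm_neq0 : rho * mu != 0 by rewrite !mulf_neq0 // lt0r_neq0.
have om_neq0 : om != 0 by rewrite /om -mulrA mulf_neq0.
pose N := 1 - d1 * rho ^+ 2 * om ^+ 4; pose G := 2 + k * om ^+ 2; pose D := G - N.
have GE : G = D + N by rewrite /D; ring.
have D1 : D = 1 + om * (k * om + d1 * rho ^+ 2 * om ^+ 3) by rewrite /D /G /N; ring.
have D_om : coprimez D om := coprimez_1mod D1.
have D_N : coprimez D N.
  apply: (@coprimez_combo _ _ (w * om ^+ 4) (G - 4) G).
    rewrite coprimezMr coprimezXr // andbT.
    by move: D_om; rewrite /om /mu !coprimezMr => /andP[_ /andP[]].
  by rewrite [in RHS]/D /w /G /N; ring.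
have [c1 [f cN]] : exists c1 f : int, N * (om ^+ 2 * c1) = 1 + D * f.
  have /coprimezP[[x y] /= xy] : coprimez D (N * om ^+ 2).
    by rewrite coprimezMr D_N coprimezXr.
  by exists y, (- x); rewrite -xy; ring.
have [X1 X1E] := @squares_base_point d2 a rho mu c1 f N G D GE cN.
exists rho, om, N, G, (2 * rho * D + om * nu * N * G * (om ^+ 2 * c1)), (h + w * X1).
split=> //.
- apply/eqP => D0; move: D1; rewrite /D D0 /om.
  set y := (y in 1 + _ * y) => /esym E.
  have : 8 * (rho * mu * y) = -1 by rewrite -[RHS]add0r -E; ring.
  by clear; lia.
- have -> : rho * (nu ^+ 2 * om ^+ 2 * N * G) = (nu * om) ^+ 2 * (rho * N * G) by ring.
  rewrite mulr_gt0 ?exprn_even_gt0 ?(mulf_neq0 nu_neq0 om_neq0) //.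
  by apply: (squares_sign rm_neq0 k_lt0 rho_sign); rewrite // /om mulrA.
rewrite -X1E -/D; congr (_ * _).
by rewrite rhoE /mu; ring.
Qed.

(** X has degree 4 in the parameter and each of the two quadratic polynomials
    becomes a product of two quartic ones. *)
Lemma factorial_dividing_of_squares (P0 : {poly int}) (d1 d2 a X0 M : int) :
    0 < M ->
    (forall n, (P0.[n] %| ((M * n + X0) ^+ 2 - d1) * ((M * n + X0 - a) ^+ 2 - d2))%Z) ->
  factorial_dividing P0.
Proof.
move=> M_gt0 P0_dvd.
have [rho [om [N [G [t0 [X1 /= params]]]]]] := squares_parameters d1 d2 a X0 M_gt0.
move: params; set nu := rho ^+ 2 - d2; set k := 2 * a * rho - rho ^+ 2 - d2.
set D := G - N; set P := nu ^+ 2 * om ^+ 2 * N * G.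
set W := P + 2 * (rho ^+ 2 + d2) * D ^+ 2; case=> NE GE D_neq0 P_rho X1E.
pose den := 8 * rho * P * D ^+ 2 * M.
have den_gt0 : 0 < den.
  rewrite /den -(mulrA 8); apply: mulr_gt0 => //; apply: mulr_gt0.
    exact: mulr_gt0.
  by rewrite exprn_even_gt0.
pose cst := 4 * k * P * D ^+ 2 - 4 * nu ^+ 2 * D ^+ 4.
pose r := 2 * rho * D; pose e := 2 * D * nu * N.
pose hh := 4 * D ^+ 2 * nu ^+ 2 * G ^+ 2 * (1 - N).
pose g := Poly [:: W ^+ 2 + cst - 8 * rho * P * D ^+ 2 * X0; 0; - 2 * W; 0; 1].
(* A1 e and A1 (- e) are the norms of Z -+ (x + y sqrt d1), and A2 r and
   A2 (- r) those of t^2 -+ 2 mu t + 4 rho sqrt d2 - x y / rho, where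
   mu = rho + sqrt d2; the parameter is D t, which clears denominators. *)
pose A1 e := Poly [:: (W + e) ^+ 2 - hh; 0; - 2 * (W + e); 0; 1].
pose A2 r := Poly [:: P ^+ 2 - 4 * d2 * D ^+ 2 * r ^+ 2;
   2 * r * P + 8 * d2 * D ^+ 2 * r; r ^+ 2 - 2 * P - 4 * d2 * D ^+ 2; - 2 * r; 1].
have size_g : size g = 5%N by rewrite size_Poly_last.
apply: (@factorial_dividing_of_split P0 g [:: A1 e; A1 (- e); A2 r; A2 (- r)] den t0 den).
- done.
- done.
- by rewrite size_g.
- by rewrite lead_coefE size_g /g (PolyK (c := 1)).
- by rewrite /= size_g !size_Poly_last.
move=> j; set t := t0 + den * j.
have gE (x : int) : g.[x] = (x ^+ 2 - W) ^+ 2 + cst - 8 * rho * P * D ^+ 2 * X0.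
  by rewrite horner_Poly /=; ring.
pose n := X1 + j * (t + t0) * (t ^+ 2 + t0 ^+ 2 - 2 * W).
have nE : den * n = g.[t].
  rewrite gE.
  have -> : (t ^+ 2 - W) ^+ 2 = (t0 ^+ 2 - W) ^+ 2
      + (den * j) * (t + t0) * (t ^+ 2 + t0 ^+ 2 - 2 * W) by rewrite /t; ring.
  have base : den * X1 = (t0 ^+ 2 - W) ^+ 2 + cst - 8 * rho * P * D ^+ 2 * X0.
    have -> : (t0 ^+ 2 - W) ^+ 2
        = 8 * rho * P * D ^+ 2 * (X0 + M * X1) - cst by rewrite X1E /cst; ring.
    by rewrite /den; ring.
  by rewrite /n mulrDr base; ring.
exists n => //.
apply: dvdz_trans (P0_dvd n) _.
set X := M * n + X0.
rewrite !big_cons big_nil mulr1.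
have XE : 8 * rho * P * D ^+ 2 * X = (t ^+ 2 - W) ^+ 2 + cst.
  by rewrite /X mulrDr mulrA -/den nE gE subrK.
(* With these two identities the equation of the conic becomes D = G - N. *)
have dN : d1 * rho ^+ 2 * om ^+ 4 = 1 - N by rewrite NE; ring.
have kG : k * om ^+ 2 = G - 2 by rewrite GE; ring.
have A1E : (A1 e).[t] * (A1 (- e)).[t]
    = (8 * rho * P * D ^+ 2) ^+ 2 * (X ^+ 2 - d1).
  have -> : (8 * rho * P * D ^+ 2) ^+ 2 * (X ^+ 2 - d1) =
    ((t ^+ 2 - W) ^+ 2 + cst) ^+ 2 - 64 * P ^+ 2 * D ^+ 4 * (d1 * rho ^+ 2).
    by rewrite -XE; ring.
  have -> : 64 * P ^+ 2 * D ^+ 4 * (d1 * rho ^+ 2)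
      = 64 * (nu ^+ 2 * N * G) ^+ 2 * D ^+ 4 * (1 - N) 
    by rewrite -dN /P; ring.
  have -> : cst = 4 * nu ^+ 2 * N * G * (G - 2) * D ^+ 2 - 4 * nu ^+ 2 * D ^+ 4.
    by rewrite -kG /cst /P; ring.
  by rewrite !horner_Poly /= /hh /e /D; ring.
have A2E : (A2 r).[t] * (A2 (- r)).[t]
    = (8 * rho * P * D ^+ 2) ^+ 2 * ((X - a) ^+ 2 - d2).
  have -> : (8 * rho * P * D ^+ 2) ^+ 2 * ((X - a) ^+ 2 - d2) =
    (8 * rho * P * D ^+ 2 * X - 8 * rho * P * D ^+ 2 * a) ^+ 2
      - (8 * rho * P * D ^+ 2) ^+ 2 * d2 by ring.
  by rewrite XE !horner_Poly /= /cst /k /W /nu /r; ring.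
rewrite mulrA A1E A2E mulrACA dvdz_mull //.
Qed.

Lemma coef_square_shift (Q : {poly int}) (x : int) : size Q = 3%N ->
  4 * Q`_2 * Q.[x] = (2 * Q`_2 * x + Q`_1) ^+ 2 - (Q`_1 ^+ 2 - 4 * Q`_2 * Q`_0).
Proof.
by move=> size_Q; rewrite horner_coef size_Q !big_ord_recr big_ord0 /=; ring.
Qed.

(** Completing both squares in the common variable X = 2 q r n + r Q`_1, where q
    and r are the leading coefficients of Q and R, gives polynomials of the form
    X^2 - d1 and (X - a)^2 - d2. *)
Lemma factorial_dividing_quadratics (P Q R : {poly int}) :
    size Q = 3%N -> size R = 3%N -> (forall n, (P.[n] %| Q.[n] * R.[n])%Z) ->
  factorial_dividing P.
Proof.
move=> size_Q size_R PQR.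
have [Q' [size_Q' leadQ QQ']] : exists Q' : {poly int},
    [/\ size Q' = size Q, 0 < lead_coef Q' & forall n, (Q.[n] %| Q'.[n])%Z].
  by apply: associate_lead_gt0; rewrite -size_poly_gt0 size_Q.
have [R' [size_R' leadR RR']] : exists R' : {poly int},
    [/\ size R' = size R, 0 < lead_coef R' & forall n, (R.[n] %| R'.[n])%Z].
  by apply: associate_lead_gt0; rewrite -size_poly_gt0 size_R.
rewrite lead_coefE size_Q' size_Q /= in leadQ; rewrite lead_coefE size_R' size_R /= in leadR.
rewrite size_Q in size_Q'; rewrite size_R in size_R'.
pose dis (S : {poly int}) := S`_1 ^+ 2 - 4 * S`_2 * S`_0.
apply: (@factorial_dividing_of_squares P (R'`_2 ^+ 2 * dis Q') (Q'`_2 ^+ 2 * dis R')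
  (R'`_2 * Q'`_1 - Q'`_2 * R'`_1) (R'`_2 * Q'`_1) (2 * Q'`_2 * R'`_2)).
  by rewrite !mulr_gt0.
move=> n; apply: dvdz_trans (PQR n) _.
apply: (@dvdz_trans (Q'.[n] * R'.[n])); first by rewrite dvdz_mul.
apply/dvdzP; exists (R'`_2 ^+ 2 * (4 * Q'`_2) * (Q'`_2 ^+ 2 * (4 * R'`_2))).
have -> : R'`_2 ^+ 2 * (4 * Q'`_2) * (Q'`_2 ^+ 2 * (4 * R'`_2)) * (Q'.[n] * R'.[n])
  = R'`_2 ^+ 2 * (4 * Q'`_2 * Q'.[n]) * (Q'`_2 ^+ 2 * (4 * R'`_2 * R'.[n])) by ring.
by rewrite !coef_square_shift // /dis; ring.
Qed.

(** * The substitution for a cubic factor *)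

(** Let y be a root of Phi = Y^3 + C Y^2 + B Y + A. The element
    delta = 2 y^2 + 2 C y + B = - B - 2 A / y of the cubic algebra has the square
    B^2 - 4 A C - 4 A y, which is of degree 1 in y. The odd cubic polynomial
    cubicH has been chosen such that cubicH(delta) has the same property: its square
    is 4 A B cubicQ y + cubicK. *)
Definition cubicQ (A B C : int) := 64 * A ^+ 2 - 16 * A * B * C + 3 * B ^+ 3.

Definition cubicH (A B C T : int) := T * (3 * B ^+ 2 - 8 * A * C - 2 * T ^+ 2).

Definition cubicK (A B C : int) := 256 * A ^+ 4 - 4 * A * B ^+ 4 * C + B ^+ 6.

(** The formula for the square of cubicH(delta), as a congruence modulo Phi. It says
    that the parameter 2 Y^2 + 2 C Y + B reproduces the argument Y up to a
    multiple of Phi(Y). *)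
Lemma cubic_base_point (A B C Y : int) :
  exists R : int, cubicH A B C (2 * Y ^+ 2 + 2 * C * Y + B) ^+ 2 - cubicK A B C
    = 4 * A * B * cubicQ A B C * Y + (Y ^+ 3 + C * Y ^+ 2 + B * Y + A) * R.
Proof.
pose Phi := Y ^+ 3 + C * Y ^+ 2 + B * Y + A.
(* G and S are the remainder and the quotient of cubicH at the parameter by Phi. *)
pose S := 16 * A - 8 * B * C - 8 * B * Y - 16 * C ^+ 2 * Y - 32 * C * Y ^+ 2 - 16 * Y ^+ 3.
pose G := 2 * B ^+ 2 * Y ^+ 2 + (2 * B ^+ 2 * C - 8 * A * B) * Y + (B ^+ 3 - 16 * A ^+ 2).
pose R := 4 * B ^+ 4 * Y + 4 * B ^+ 4 * C - 32 * A * B ^+ 3.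
have HE : cubicH A B C (2 * Y ^+ 2 + 2 * C * Y + B) = G + Phi * S.
  by rewrite /cubicH /G /Phi /S; ring.
have GE : G ^+ 2 = cubicK A B C + 4 * A * B * cubicQ A B C * Y + Phi * R.
  by rewrite /cubicK /cubicQ /G /Phi /R; ring.
exists (R + 2 * S * G + Phi * S ^+ 2); rewrite HE -/Phi.
have -> : (G + Phi * S) ^+ 2 = G ^+ 2 + Phi * (2 * S * G + Phi * S ^+ 2) by ring.
by rewrite GE; ring.
Qed.

(** For s = 1 the norm of T - delta, for s = - 1 that of T + delta up to sign. *)
Definition cubicN1 (A B C s : int) : {poly int} := Poly
  [:: - (8 * A ^+ 2 - 4 * A * B * C + B ^+ 3); s * (4 * A * C - B ^+ 2); B; s].

(** The norms of the cofactors (cubicH(T) -+ cubicH(delta)) / (T -+ delta). *)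
Definition cubicN2 (A B C s : int) : {poly int} := Poly
  [:: - 512 * A ^+ 4 + 64 * A ^+ 2 * B ^+ 3 - 8 * A * B ^+ 4 * C + B ^+ 6;
      s * (512 * A ^+ 3 * C - 224 * A ^+ 2 * B ^+ 2 + 2 * B ^+ 5);
      - 64 * A ^+ 2 * B - 128 * A ^+ 2 * C ^+ 2 + 80 * A * B ^+ 2 * C - 10 * B ^+ 4;
      s * (128 * A ^+ 2 + 32 * A * B * C - 16 * B ^+ 3);
      20 * B ^+ 2 - 64 * A * C; s * (8 * B); - 8].

(** Since 4 A B Q (Y - y) = cubicH(T)^2 - cubicH(delta)^2 and cubicH is odd, Y - y is
    divisible by T - delta and by T + delta. The cofactors have degree 2, so Phi(Y),
    being the norm of Y - y, splits into degrees 3, 6, 3, 6 in T, while Y has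
    degree 6. *)
Lemma cubic_split (A B C Y T : int) :
    4 * A * B * cubicQ A B C * Y = cubicH A B C T ^+ 2 - cubicK A B C ->
  (4 * A * B * cubicQ A B C) ^+ 3 * (Y ^+ 3 + C * Y ^+ 2 + B * Y + A)
    = - ((cubicN1 A B C 1).[T] * (cubicN2 A B C 1).[T]
         * ((cubicN1 A B C (-1)).[T] * (cubicN2 A B C (-1)).[T])).
Proof.
set D := 4 * A * B * _; set K := cubicK A B C; move=> DY.
(* NG is the characteristic polynomial of cubicH(delta). *)
pose g1 := 8 * A * B * C - 48 * A ^+ 2 - B ^+ 3.
pose g2 := 768 * A ^+ 4 - 256 * A ^+ 3 * B * C + 48 * A ^+ 2 * B ^+ 3 + 4 * A * B ^+ 4 * C
  - B ^+ 6.
pose g3 := - 4096 * A ^+ 6 + 2048 * A ^+ 5 * B * C - 320 * A ^+ 3 * B ^+ 4 * C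
  + 72 * A ^+ 2 * B ^+ 6 + 32 * A ^+ 2 * B ^+ 5 * C ^+ 2 - 12 * A * B ^+ 7 * C + B ^+ 9.
pose NG U := U ^+ 3 - g1 * U ^+ 2 + g2 * U - g3.
have NGE : NG (cubicH A B C T) = (cubicN1 A B C 1).[T] * (cubicN2 A B C 1).[T].
  by rewrite !horner_Poly /= /NG /g1 /g2 /g3 /cubicH; ring.
have NGNE : NG (- cubicH A B C T) = (cubicN1 A B C (-1)).[T] * (cubicN2 A B C (-1)).[T].
  by rewrite !horner_Poly /= /NG /g1 /g2 /g3 /cubicH; ring.
rewrite -NGE -NGNE.
move: (cubicH A B C T) DY => H DY.
have -> : D ^+ 3 * (Y ^+ 3 + C * Y ^+ 2 + B * Y + A)
    = (D * Y) ^+ 3 + C * D * (D * Y) ^+ 2 + B * D ^+ 2 * (D * Y) + A * D ^+ 3 by ring.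
by rewrite DY /NG /g1 /g2 /g3 /D /K /cubicK /cubicQ; ring.
Qed.

(** * Integral points of the cubic substitution *)

Lemma dvdz_congr_cubic (p q m x y : int) : (m %| x - y)%Z ->
  (m %| y ^+ 3 + p * y + q)%Z -> (m %| x ^+ 3 + p * x + q)%Z.
Proof.
move=> xy m_y.
have -> : x ^+ 3 + p * x + q = (x - y) * (x ^+ 2 + x * y + y ^+ 2 + p) + (y ^+ 3 + p * y + q).
  by ring.
by apply: rpredD => //; apply: dvdz_mulr.
Qed.

Lemma cubic_root_mul (p q m1 m2 z1 z2 : int) : coprimez m1 m2 ->
    (m1 %| z1 ^+ 3 + p * z1 + q)%Z -> (m2 %| z2 ^+ 3 + p * z2 + q)%Z ->
  exists z : int, (m1 * m2 %| z ^+ 3 + p * z + q)%Z.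
Proof.
move=> co m1_z1 m2_z2; have [z [z_z1 z_z2]] := crt z1 z2 co.
exists z; rewrite Gauss_dvdz //.
by rewrite (dvdz_congr_cubic z_z1) // (dvdz_congr_cubic z_z2).
Qed.

Lemma cubic_positive_core (c b P S : int) : 120 <= c -> 0 < b ->
    c * `|P| <= b ^+ 2 -> c * `|S| <= b ^+ 3 ->
  [/\ 0 < b ^+ 3 + P * b + S, 0 < 3 * b ^+ 2 + P &
      0 < b ^+ 6 + 17 * (P * b ^+ 4) - 16 * (S * b ^+ 3) + 43 * (P * b) ^+ 2
          + 80 * (P * S * b) + 64 * S ^+ 2 + 3 * P ^+ 3].
Proof.
move=> c_ge b_gt0 P_le S_le; have b_ge0 := ltW b_gt0.
(* 120 exceeds 17 + 16 + 80 + 3, the coefficients of the terms without a sign. *)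
have small (x y : int) : c * `|x| <= y -> 120 * - x <= y /\ 120 * x <= y.
  move=> le_y; have : 120 * `|x| <= c * `|x| by rewrite ler_wpM2r.
  by move: (c * `|x|) le_y; clear; lia.
have c_ge1 : 1 <= c by move: c_ge; clear; lia.
have P_le1 : `|P| <= b ^+ 2 by apply: le_trans P_le; rewrite ler_peMl.
have S_le1 : `|S| <= b ^+ 3 by apply: le_trans S_le; rewrite ler_peMl.
have b2_ge0 := exprn_ge0 2 b_ge0; have b3_ge0 := exprn_ge0 3 b_ge0.
have b4_ge0 := exprn_ge0 4 b_ge0.
have [Pb _] : 120 * - (P * b) <= b ^+ 3 /\ 120 * (P * b) <= b ^+ 3.
  by apply: small; rewrite normrM (ger0_norm b_ge0) mulrA [b ^+ 3]exprSr ler_wpM2r.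
have [Pb4 _] : 120 * - (P * b ^+ 4) <= b ^+ 6 /\ 120 * (P * b ^+ 4) <= b ^+ 6.
  by apply: small; rewrite normrM (ger0_norm b4_ge0) mulrA [b ^+ 6](exprD b 2 4) ler_wpM2r.
have [_ Sb3] : 120 * - (S * b ^+ 3) <= b ^+ 6 /\ 120 * (S * b ^+ 3) <= b ^+ 6.
  by apply: small; rewrite normrM (ger0_norm b3_ge0) mulrA [b ^+ 6](exprD b 3 3) ler_wpM2r.
have [PSb _] : 120 * - (P * S * b) <= b ^+ 6 /\ 120 * (P * S * b) <= b ^+ 6.
  apply: small; rewrite !normrM (ger0_norm b_ge0) !mulrA [b ^+ 6]exprSr ler_wpM2r //.
  by rewrite [b ^+ 5](exprD b 2 3) ler_pM // mulr_ge0 // (le_trans _ c_ge1).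
have [P3 _] : 120 * - P ^+ 3 <= b ^+ 6 /\ 120 * P ^+ 3 <= b ^+ 6.
  apply: small; rewrite normrX [b ^+ 6](exprM b 2 3) (exprS `|P|) (exprS (b ^+ 2)) mulrA.
  by rewrite ler_pM ?exprn_ge0 ?lerXn2r ?nnegrE // mulr_ge0 // (le_trans _ c_ge1).
have [P_ge _] := small _ _ P_le; have [S_ge _] := small _ _ S_le.
have b2_gt0 := exprn_gt0 2 b_gt0; have b3_gt0 := exprn_gt0 3 b_gt0.
have b6_gt0 := exprn_gt0 6 b_gt0.
have Pb_sqr := sqr_ge0 (P * b); have S_sqr := sqr_ge0 S.
split.
- move: (P * b) (b ^+ 3) Pb b3_gt0 S_ge; clear; lia.
- move: (b ^+ 2) P_ge b2_gt0; clear; lia.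
move: (P * b ^+ 4) (S * b ^+ 3) (P * S * b) (P ^+ 3) (b ^+ 6) ((P * b) ^+ 2) (S ^+ 2)
  Pb4 Sb3 PSb P3 b6_gt0 Pb_sqr S_sqr; clear; lia.
Qed.

(** For b / a large the three numbers are close to b^3, 3 b^2 and b^6. *)
Lemma cubic_positive (p q a b c : int) : 120 <= c ->
    0 < a -> c * (`|p| + `|q| + 1) * a <= b ->
    let A := b ^+ 3 + p * a ^+ 2 * b + q * a ^+ 3 in
    let B := 3 * b ^+ 2 + p * a ^+ 2 in
  [/\ 0 < A, 0 < B & 0 < cubicQ A B (3 * b)].
Proof.
move=> c_ge a_gt0; set K := c * _ => Ka_le A B.
have a_ge0 := ltW a_gt0.
have c_gt0 : 0 < c by move: c_ge; clear; lia.
have K_ge (x : int) : x <= `|p| + `|q| + 1 -> c * x <= K by move=> x_le; rewrite ler_pM2l.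
have K_ge1 : 1 <= K.
  by apply: le_trans (K_ge 1 _); rewrite ?mulr1 -?gtz0_ge1 //; clear; lia.
have K_ge0 : 0 <= K by apply: le_trans K_ge1.
have Ka_ge0 : 0 <= K * a by rewrite mulr_ge0.
have b_gt0 : 0 < b by apply: lt_le_trans Ka_le; rewrite mulr_gt0 // -gtz0_ge1.
have K_pow (d : nat) : K <= K ^+ d.+1 by rewrite exprS ler_peMr // exprn_ege1.
have Ka_pow (d : nat) : (K * a) ^+ d <= b ^+ d by rewrite lerXn2r ?nnegrE // ltW.
have coef_le (x : int) (d : nat) : `|x| <= `|p| + `|q| + 1 ->
    c * `|x * a ^+ d.+1| <= b ^+ d.+1.
  move=> x_le; apply: le_trans (Ka_pow d.+1).
  rewrite normrM (ger0_norm (exprn_ge0 _ a_ge0)) mulrA exprMn.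
  by rewrite ler_wpM2r ?exprn_ge0 // (le_trans (K_ge _ x_le)).
have P_le : c * `|p * a ^+ 2| <= b ^+ 2 by apply: coef_le; clear; lia.
have S_le : c * `|q * a ^+ 3| <= b ^+ 3 by apply: coef_le; clear; lia.
have [A_gt0 B_gt0 Q_gt0] := cubic_positive_core c_ge b_gt0 P_le S_le.
split=> //; apply: lt_le_trans Q_gt0 _.
rewrite le_eqVlt; apply/orP; left; apply/eqP.
by rewrite /cubicQ /A /B; ring.
Qed.

(** The quotient of the two expressions is about W / (9 V) when W is large. *)
Lemma cubic_scale (p q V K : int) : 0 < V -> 0 <= K ->
  exists h : int, let W := 1 + V * h in
    let a := 9 * V * (W ^+ 2 + 2 * p * V ^+ 2) in
    0 < a /\ K * a <= W ^+ 3 + 27 * q * V ^+ 3.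
Proof.
move=> V_gt0 K_ge0; have V_ge0 := ltW V_gt0.
pose h := 18 * K + 27 * `|q| * V ^+ 2 + (2 * `|p| + 1).
exists h; cbv zeta; set W := 1 + V * h.
have KV_ge0 : 0 <= 18 * (K * V) by rewrite !mulr_ge0.
have qV_ge0 : 0 <= 27 * (`|q| * V ^+ 3) by rewrite !mulr_ge0 ?exprn_ge0.
have pV_ge0 : 0 <= V * (2 * `|p| + 1) by rewrite mulr_ge0 // addr_ge0 ?mulr_ge0.
have WE : W = 1 + 18 * (K * V) + 27 * (`|q| * V ^+ 3) + V * (2 * `|p| + 1).
  by rewrite /W /h; ring.
have W_ge1 : 1 <= W by rewrite WE; move: KV_ge0 qV_ge0 pV_ge0; clear; lia.
have W_ge : 18 * (K * V) + 27 * (`|q| * V ^+ 3) <= W.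
  by rewrite WE; move: KV_ge0 qV_ge0 pV_ge0; clear; lia.
have W_ge' : V * (2 * `|p| + 1) <= W.
  by rewrite WE; move: KV_ge0 qV_ge0 pV_ge0; clear; lia.
have W_ge0 : 0 <= W by apply: le_trans W_ge1.
have W2_ge : V ^+ 2 * (2 * `|p| + 1) <= W ^+ 2.
  apply: (@le_trans _ _ ((V * (2 * `|p| + 1)) ^+ 2)).
    rewrite exprMn ler_wpM2l ?sqr_ge0 // expr2 ler_peMr //; clear; lia.
  by rewrite lerXn2r ?nnegrE.
have V2_gt0 : 0 < V ^+ 2 by rewrite exprn_gt0.
have [pV1 pV2] : - (V ^+ 2 * `|p|) <= p * V ^+ 2 /\ p * V ^+ 2 <= V ^+ 2 * `|p|.
  rewrite [p * _]mulrC -mulrN !ler_pM2l // ler_norm; split=> //.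
  by rewrite lerNl -normrN ler_norm.
have W2_ge' : 2 * (V ^+ 2 * `|p|) + V ^+ 2 <= W ^+ 2.
  by apply: le_trans W2_ge; rewrite le_eqVlt; apply/orP; left; apply/eqP; ring.
have SE : W ^+ 2 + 2 * p * V ^+ 2 = W ^+ 2 + 2 * (p * V ^+ 2) by ring.
have S_gt0 : 0 < W ^+ 2 + 2 * p * V ^+ 2.
  rewrite SE; move: (W ^+ 2) (V ^+ 2) (V ^+ 2 * `|p|) (p * V ^+ 2) pV1 V2_gt0 W2_ge'.
  by clear; lia.
have S_le : W ^+ 2 + 2 * p * V ^+ 2 <= 2 * W ^+ 2.
  rewrite SE; move: (W ^+ 2) (V ^+ 2) (V ^+ 2 * `|p|) (p * V ^+ 2) pV2 V2_gt0 W2_ge'.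
  by clear; lia.
split; first by rewrite !mulr_gt0.
have W2_ge1 : 1 <= W ^+ 2 by rewrite exprn_ege1.
have step1 : K * (9 * V * (W ^+ 2 + 2 * p * V ^+ 2)) <= 18 * (K * V) * W ^+ 2.
  have -> : K * (9 * V * (W ^+ 2 + 2 * p * V ^+ 2))
    = (9 * (K * V)) * (W ^+ 2 + 2 * p * V ^+ 2) by ring.
  have -> : 18 * (K * V) * W ^+ 2 = (9 * (K * V)) * (2 * W ^+ 2) by ring.
  by rewrite ler_wpM2l // !mulr_ge0.
apply: le_trans step1 _.
have step2 : (18 * (K * V) + 27 * (`|q| * V ^+ 3)) * W ^+ 2 <= W ^+ 3.
  by rewrite [W ^+ 3]exprS ler_wpM2r // (le_trans _ W2_ge1).
have step3 : 27 * (`|q| * V ^+ 3) <= 27 * (`|q| * V ^+ 3) * W ^+ 2.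
  by rewrite ler_peMr.
have step4 : - (`|q| * V ^+ 3) <= q * V ^+ 3.
  by rewrite -mulNr ler_wpM2r ?exprn_ge0 // lerNl -normrN ler_norm.
move: step2; rewrite mulrDl -[27 * q * _]mulrA.
move: (W ^+ 3) (18 * (K * V) * W ^+ 2) (27 * (`|q| * V ^+ 3) * W ^+ 2)
  (`|q| * V ^+ 3) (q * V ^+ 3) step3 step4; clear; lia.
Qed.

(** Modulo a the numbers A, B1 and Q are powers of b; the other common divisors
    divide resultants, whose primes have been put into V. *)
Lemma cubic_coprimality (p q V h W a1 a b A B1 Q : int) :
    W = 1 + V * h -> a1 = 3 * V * (W ^+ 2 + 2 * p * V ^+ 2) -> a = 3 * a1 ->
    b = W ^+ 3 + 27 * q * V ^+ 3 -> A = b ^+ 3 + p * a ^+ 2 * b + q * a ^+ 3 ->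
    B1 = b ^+ 2 + 3 * p * a1 ^+ 2 -> Q = cubicQ A (3 * B1) (3 * b) ->
    (6 %| V)%Z -> (4 * p ^+ 3 + 27 * q ^+ 2 %| V)%Z ->
    (8 * p ^+ 3 + 729 * q ^+ 2 %| V)%Z ->
  [/\ coprimez A a, coprimez B1 a, coprimez Q a, coprimez A B1 & coprimez (A * B1) Q].
Proof.
move=> WE a1E aE bE AE B1E QE six_V disc_V e_V.
have V_a : (V %| a)%Z.
  apply/dvdzP; exists (9 * (W ^+ 2 + 2 * p * V ^+ 2)); rewrite aE a1E; ring.
have six_a := dvdz_trans six_V V_a.
have two_a : (2 %| a)%Z by apply: dvdz_trans six_a.
have three_a : (3 %| a)%Z by apply: dvdz_trans six_a.
have b_V : coprimez b V.
  apply: (@coprimez_1mod _ _ (h * (3 + 3 * V * h + V ^+ 2 * h ^+ 2) + 27 * q * V ^+ 2)).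
  by rewrite bE WE; ring.
have b_3 : coprimez b 3 by apply: coprimez_dvd b_V; apply: dvdz_trans six_V.
(* The resultant of y^2 + 2 p and y^3 + 27 q is 8 p^3 + 729 q^2. *)
have b_a : coprimez b a.
  have -> : a = 3 ^+ 2 * V * (W ^+ 2 + 2 * p * V ^+ 2) by rewrite aE a1E; ring.
  rewrite 2!coprimezMr (coprimezXr 2 b_3) b_V /=.
  apply: (@coprimez_combo _ _ (V ^+ 4 * (8 * p ^+ 3 + 729 * q ^+ 2))
    (27 * q * V + 2 * p * W) (4 * p ^+ 2 * V ^+ 2 - W * (27 * q * V + 2 * p * W))).
    by rewrite coprimezMr (coprimezXr 4 b_V) (coprimez_dvd e_V).
  by rewrite bE; ring.
have A_a : coprimez A a.
  rewrite coprimez_sym; apply: (@coprimez_combo _ _ (b ^+ 3) (- (p * a * b + q * a ^+ 2)) 1).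
    by rewrite coprimezXr // coprimez_sym.
  by rewrite AE; ring.
have B1_a : coprimez B1 a.
  rewrite coprimez_sym; apply: (@coprimez_combo _ _ (b ^+ 2) (- (p * a1)) 1).
    by rewrite coprimezXr // coprimez_sym.
  by rewrite B1E aE; ring.
have Q_a : coprimez Q a.
  rewrite coprimez_sym; apply: (@coprimez_combo _ _ (b ^+ 6)
    (- (17 * p * a * b ^+ 4 - 16 * q * a ^+ 2 * b ^+ 3 + 43 * p ^+ 2 * a ^+ 3 * b ^+ 2
        + 80 * p * q * a ^+ 4 * b + 64 * q ^+ 2 * a ^+ 5 + 3 * p ^+ 3 * a ^+ 5)) 1).
    by rewrite coprimezXr // coprimez_sym.
  by rewrite QE /cubicQ AE B1E aE; ring.
(* A and B1 are f and f' / 3 at b / a up to powers of a, whence the discriminant. *)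
have A_B1 : coprimez A B1.
  apply: (@coprimez_combo _ _ ((4 * p ^+ 3 + 27 * q ^+ 2) * a ^+ 4)
    (27 * q * a - 18 * p * b)
    (3 * (6 * p * b ^+ 2 - 9 * q * a * b + 4 * p ^+ 2 * a ^+ 2))).
    by rewrite coprimezMr (coprimezXr 4 A_a) andbT (coprimez_dvd (dvdz_trans disc_V V_a)).
  by rewrite AE B1E aE; ring.
split=> //; rewrite coprimezMl; apply/andP; split.
  apply: (@coprimez_combo _ _ (3 ^+ 4 * B1 ^+ 3) (16 * (3 * B1) * (3 * b) - 64 * A) 1).
    by rewrite coprimezMr (coprimezXr 3 A_B1) (coprimezXr 4 (coprimez_dvd three_a A_a)).
  by rewrite QE /cubicQ; ring.
apply: (@coprimez_combo _ _ (2 ^+ 6 * A ^+ 2) (16 * A * 3 * (3 * b) - 81 * B1 ^+ 2) 1).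
  rewrite coprimezMr (coprimezXr 6 (coprimez_dvd two_a B1_a)).
  by rewrite coprimezXr // coprimez_sym.
by rewrite QE /cubicQ; ring.
Qed.

(** Here f = X^3 + p X + q, m = b / a, and A, B, C are the Taylor coefficients of
    f at m, up to powers of a. If f(z) is divisible by A, B / 3 and Q, then by
    cubic_base_point the parameter T0 obtained from Y = a z - b yields
    X = z + a^2 f(z) R / (4 A B Q), an integer congruent to z modulo M because
    12 M divides a. Roots of f modulo f(m) and modulo Q exist for every m, but
    not modulo f'(m). Therefore m = (x^3 + q) / (3 x^2 + 2 p / 3) with
    x = W / (3 V): then f(x - m) = f'(m) (x - m / 3). *)
Lemma cubic_parameters (p q M X0 : int) : 0 < M ->
    4 * p ^+ 3 + 27 * q ^+ 2 != 0 -> 8 * p ^+ 3 + 729 * q ^+ 2 != 0 ->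
  exists a b T0 X1 : int,
    let A := b ^+ 3 + p * a ^+ 2 * b + q * a ^+ 3 in
    let B := 3 * b ^+ 2 + p * a ^+ 2 in let Q := cubicQ A B (3 * b) in
  [/\ 0 < a, 0 < A, 0 < B, 0 < Q &
     4 * A * B * Q * (a * (X0 + M * X1) - b) = cubicH A B (3 * b) T0 ^+ 2 - cubicK A B (3 * b)].
Proof.
move=> M_gt0 disc_neq0 e_neq0.
set disc := 4 * p ^+ 3 + _ in disc_neq0; set e := 8 * p ^+ 3 + _ in e_neq0.
pose V := 12 * M * (disc * e) ^+ 2.
have de_gt0 : 0 < (disc * e) ^+ 2 by rewrite exprn_even_gt0 // mulf_neq0.
have V_gt0 : 0 < V by rewrite mulr_gt0 // mulr_gt0.
have V12 : (12 * M %| V)%Z by rewrite dvdz_mulr.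
have six_V : (6 %| V)%Z.
  by apply: dvdz_trans V12; apply: dvdz_mulr.
have disc_V : (disc %| V)%Z.
  by apply/dvdzP; exists (12 * M * (disc * e) * e); rewrite /V; ring.
have e_V : (e %| V)%Z.
  by apply/dvdzP; exists (12 * M * (disc * e) * disc); rewrite /V; ring.
have K_ge0 : 0 <= 120 * (`|p| + `|q| + 1) by rewrite mulr_ge0 // addr_ge0 // addr_ge0.
have [h] := @cubic_scale p q V _ V_gt0 K_ge0.
cbv zeta; set W := 1 + V * h; set a := 9 * V * _; set b := W ^+ 3 + _ => -[a_gt0 Ka_le].
pose A := b ^+ 3 + p * a ^+ 2 * b + q * a ^+ 3.
pose B := 3 * b ^+ 2 + p * a ^+ 2; pose Q := cubicQ A B (3 * b).
have [A_gt0 B_gt0 Q_gt0] := cubic_positive (lexx 120) a_gt0 Ka_le.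
rewrite -/A -/B -/Q in A_gt0 B_gt0 Q_gt0.
pose a1 := 3 * V * (W ^+ 2 + 2 * p * V ^+ 2).
pose B1 := b ^+ 2 + 3 * p * a1 ^+ 2.
have aE : a = 3 * a1 by rewrite /a /a1; ring.
have BE : B = 3 * B1 by rewrite /B /B1 aE; ring.
have [A_a B1_a Q_a A_B1 AB1_Q] : [/\ coprimez A a, coprimez B1 a, coprimez Q a,
    coprimez A B1 & coprimez (A * B1) Q].
  by apply: (@cubic_coprimality p q V h W a1 a b) => //; rewrite -BE.
have V_a : (V %| a)%Z by rewrite /a dvdz_mulr // dvdz_mull.
have a12 : (12 * M %| a)%Z by apply: dvdz_trans V12 V_a.
have three_a : (3 %| a)%Z by rewrite aE dvdz_mulr.
pose f z := z ^+ 3 + p * z + q.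
pose Phi Y := Y ^+ 3 + 3 * b * Y ^+ 2 + B * Y + A.
have fE z : a ^+ 3 * f z = Phi (a * z - b) by rewrite /f /Phi /A /B; ring.
have PhiE Y : Phi Y = Y * (Y ^+ 2 + 3 * b * Y + B) + A by rewrite /Phi; ring.
(* Modulo A the root is m. *)
have [zA zAP] : exists z, (A %| f z)%Z.
  have [z z_dvd] := linear_congruence b A_a; exists z.
  rewrite -(@Gauss_dvdzr _ (a ^+ 3)) ?coprimezXr // fE PhiE.
  by apply: rpredD => //; apply: dvdz_mulr.
(* Modulo B1 the root is x - m. *)
have [zB zBP] : exists z, (B1 %| f z)%Z.
  have B1_3Va : coprimez B1 (3 * V * a).
    by rewrite 2!coprimezMr B1_a (coprimez_dvd three_a B1_a) (coprimez_dvd V_a B1_a).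
  have [z z_dvd] := linear_congruence (W * a - 3 * V * b) B1_3Va; exists z.
  rewrite -(@Gauss_dvdzr _ ((3 * V * a) ^+ 3)) ?coprimezXr //.
  set x := 3 * V * a * z in z_dvd; set y := W * a - _ in z_dvd.
  have -> : (3 * V * a) ^+ 3 * f z = x ^+ 3 + p * (3 * V * a) ^+ 2 * x + q * (3 * V * a) ^+ 3.
    by rewrite /f /x; ring.
  apply: (dvdz_congr_cubic z_dvd).
  by apply/dvdzP; exists (3 * 9 * V ^+ 2 * (W * a - V * b)); rewrite /y /B1 aE /a1 /b; ring.
(* Modulo Q the root is m - 4 f(m) / f'(m), where Phi takes the value - A Q / B^3. *)
have [zQ zQP] : exists z, (Q %| f z)%Z.
  have Q_B : coprimez Q B.
    rewrite BE coprimezMr (coprimez_dvd three_a Q_a) coprimez_sym.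
    by move: AB1_Q; rewrite coprimezMl => /andP[].
  have Q_aB : coprimez Q (a * B) by rewrite coprimezMr Q_a.
  have [z z_dvd] := linear_congruence (b * B - 4 * A) Q_aB; exists z.
  rewrite -(@Gauss_dvdzr _ ((a * B) ^+ 3)) ?coprimezXr //.
  set x := a * B * z - _ in z_dvd.
  have -> : (a * B) ^+ 3 * f z = x * (x ^+ 2 + (3 * b * B - 12 * A) * x + 48 * A ^+ 2
     - 24 * A * B * b + B ^+ 3) + - A * Q.
    have -> : (a * B) ^+ 3 * f z = B ^+ 3 * (a ^+ 3 * f z) by ring.
    have -> : x = B * (a * z - b) + 4 * A by rewrite /x; ring.
    by rewrite fE /Phi /Q /cubicQ; ring.
  by apply: rpredD; [apply: dvdz_mulr | apply: dvdz_mull].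
have [zAB zABP] := cubic_root_mul A_B1 zAP zBP.
have [z0 z0P] := cubic_root_mul AB1_Q zABP zQP.
have N_M : coprimez (A * B1 * Q) M.
  apply: (@coprimez_dvd _ a); first by apply: dvdz_trans a12; rewrite dvdz_mull.
  by rewrite !coprimezMl A_a B1_a.
have [z [z_z0 /dvdzP[z1 z_X0]]] := crt z0 X0 N_M.
have /dvdzP[s fz] := dvdz_congr_cubic z_z0 z0P.
have [w aw] := dvdzP a12.
pose Y := a * z - b.
have [R HR] := cubic_base_point A B (3 * b) Y.
exists a, b, (2 * Y ^+ 2 + 2 * (3 * b) * Y + B), (z1 + w * a * s * R); split=> //.
rewrite -/A -/B -/Q HR -/(Phi Y) -fE -/Q.
have -> : f z = s * (A * B1 * Q) by rewrite -fz.
have -> : X0 + M * (z1 + w * a * s * R) = (z1 * M + X0) + M * w * a * s * R by ring.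
rewrite -z_X0 subrK.
have -> : a ^+ 3 = a ^+ 2 * (w * (12 * M)) by rewrite -aw; ring.
by rewrite BE /Y; ring.
Qed.

(** * Reducible quartic polynomials *)

Lemma factorial_dividing_linear_cubic (P0 L : {poly int}) (p q X0 M : int) :
    0 < M -> 4 * p ^+ 3 + 27 * q ^+ 2 != 0 -> 8 * p ^+ 3 + 729 * q ^+ 2 != 0 ->
    size L = 2%N ->
    (forall n, (P0.[n] %| L.[n] * ((M * n + X0) ^+ 3 + p * (M * n + X0) + q))%Z) ->
  factorial_dividing P0.
Proof.
move=> M_gt0 disc_neq0 e_neq0 size_L P0_dvd.
have [a [b [T0 [X1 /= params]]]] := cubic_parameters X0 M_gt0 disc_neq0 e_neq0.
move: params; set A := b ^+ 3 + _ + _; set B := 3 * b ^+ 2 + _; set C := 3 * b.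
set Q := cubicQ A B C; case=> a_gt0 A_gt0 B_gt0 Q_gt0 X1E.
pose D := 4 * A * B * Q.
have D_gt0 : 0 < D by rewrite mulr_gt0 // mulr_gt0 // mulr_gt0.
pose den := D * a * M.
have den_gt0 : 0 < den by rewrite mulr_gt0 // mulr_gt0.
pose F := 3 * B ^+ 2 - 8 * A * C.
pose g := Poly [:: D * (b - a * X0) - cubicK A B C; 0; F ^+ 2; 0; - 4 * F; 0; 4].
have gE (x : int) : g.[x] = cubicH A B C x ^+ 2 - cubicK A B C + D * (b - a * X0).
  by rewrite horner_Poly /= /cubicH -/F; ring.
have size_g : size g = 7%N by rewrite size_Poly_last.
pose Lg := L`_1 *: g + (den * L`_0)%:P.
have size_Lg : size Lg = 7%N.
  have L1_neq0 : L`_1 != 0.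
    by have := lead_coef_eq0 L; rewrite lead_coefE size_L /= -size_poly_eq0 size_L => ->.
  by rewrite size_polyDl size_scale ?size_g // (leq_ltn_trans (size_polyC_leq1 _)).
have LgE (x n : int) : den * n = g.[x] -> Lg.[x] = den * L.[n].
  move=> den_n; rewrite hornerD hornerZ hornerC -den_n.
  by rewrite (horner_coef L) size_L !big_ord_recr big_ord0 /=; ring.
have neg1_neq0 : (-1 : int) != 0 by [].
apply: (@factorial_dividing_of_split P0 g
  [:: Lg; cubicN1 A B C 1; cubicN2 A B C 1; cubicN1 A B C (-1); cubicN2 A B C (-1)]
  den T0 den) => //.
- by rewrite size_g.
- by rewrite lead_coefE size_g /g (PolyK (c := 1)).
- by rewrite /= size_g size_Lg !size_Poly_last.
move=> j; set t := T0 + den * j.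
pose u := (t + T0) * (F ^+ 2 - 4 * F * (t ^+ 2 + T0 ^+ 2)
  + 4 * (t ^+ 4 + t ^+ 2 * T0 ^+ 2 + T0 ^+ 4)).
have HtE : cubicH A B C t ^+ 2 = cubicH A B C T0 ^+ 2 + den * (j * u).
  have -> : den * (j * u) = (t - T0) * u by rewrite /t; ring.
  by rewrite /cubicH -/F /u; ring.
have nE : den * (X1 + j * u) = g.[t].
  have H0E : cubicH A B C T0 ^+ 2 = D * (a * (X0 + M * X1) - b) + cubicK A B C.
    by rewrite X1E subrK.
  by rewrite gE HtE H0E /den; ring.
exists (X1 + j * u) => //; set n := X1 + j * u in nE *.
apply: dvdz_trans (P0_dvd n) _; set X := M * n + X0.
rewrite !big_cons big_nil mulr1 (LgE _ _ nE).
have XE : 4 * A * B * cubicQ A B C * (a * X - b) = cubicH A B C t ^+ 2 - cubicK A B C.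
  rewrite -[RHS](addrK (D * (b - a * X0))) -gE -nE -/Q -/D /den /X; ring.
have := cubic_split XE; set Phi := _ + A => PhiE.
have {}PhiE0 : Phi = a ^+ 3 * (X ^+ 3 + p * X + q) by rewrite /Phi /A /B /C; ring.
apply/dvdzP; exists (- (den * (D * a) ^+ 3)).
rewrite [(cubicN1 _ _ _ 1).[t] * _]mulrA -[X in _ * X = _]opprK -PhiE PhiE0 -/D.
by ring.
Qed.

(** A rational root of the cubic factor regroups P0 into two quadratics. *)
Lemma factorial_dividing_linear_split_cubic (P0 L : {poly int})
    (M X0 u v r2 r1 r0 : int) :
    M != 0 -> u != 0 -> r2 != 0 -> size L = 2%N ->
    (forall n, (P0.[n] %| L.[n] * ((u * (M * n + X0) + v)
       * (r2 * (M * n + X0) ^+ 2 + r1 * (M * n + X0) + r0)))%Z) ->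
  factorial_dividing P0.
Proof.
move=> M_neq0 u_neq0 r2_neq0 size_L P0_dvd.
pose l := Poly [:: u * X0 + v; u * M].
pose R := Poly [:: r2 * X0 ^+ 2 + r1 * X0 + r0; 2 * r2 * M * X0 + r1 * M; r2 * M ^+ 2].
have size_l : size l = 2%N by rewrite size_Poly_last //= mulf_neq0.
have size_R : size R = 3%N by rewrite size_Poly_last //= mulf_neq0 // expf_neq0.
have size_Ll : size (L * l) = 3%N.
  by rewrite size_mul -?size_poly_gt0 ?size_L ?size_l.
apply: (factorial_dividing_quadratics size_Ll size_R) => n.
apply: dvdz_trans (P0_dvd n) _; apply/dvdzP; exists 1.
by rewrite hornerM !horner_Poly /=; ring.
Qed.

Lemma cubic_depressed (Q : {poly int}) (n : int) : size Q = 4%N ->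
  let X := 3 * Q`_3 * n + Q`_2 in
  27 * Q`_3 ^+ 2 * Q.[n] = X ^+ 3 + (9 * Q`_3 * Q`_1 - 3 * Q`_2 ^+ 2) * X
    + (2 * Q`_2 ^+ 3 - 9 * Q`_1 * Q`_2 * Q`_3 + 27 * Q`_3 ^+ 2 * Q`_0).
Proof.
by move=> size_Q X; rewrite horner_coef size_Q !big_ord_recr big_ord0 /= /X; ring.
Qed.

(** The variable X = 3 R`_3 n + R`_2 depresses the cubic to X^3 + p X + q. When one
    of the two numbers required to be nonzero above vanishes, this polynomial
    has a rational root. *)
Lemma factorial_dividing_linear_mul_cubic (L R : {poly int}) :
  size L = 2%N -> size R = 4%N -> factorial_dividing (L * R).
Proof.
move=> size_L; wlog lead_R : R / 0 < R`_3.
  move=> wlogR size_R; have R3_neq0 : R`_3 != 0.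
    by have := lead_coef_eq0 R; rewrite lead_coefE size_R /= -size_poly_eq0 size_R => ->.
  case: (ltP 0 R`_3) => [R3_gt0|R3_le0]; first exact: wlogR.
  apply: (@factorial_dividing_dvd _ (L * - R)).
    by move=> n; rewrite mulrN hornerN rpredN.
  by apply: wlogR; rewrite ?size_polyN // coefN oppr_gt0 lt_neqAle R3_neq0.
move=> size_R; set c := R`_3 in lead_R.
have [p [q [X0 fE]]] : exists p q X0 : int, forall n,
    27 * c ^+ 2 * R.[n] = (3 * c * n + X0) ^+ 3 + p * (3 * c * n + X0) + q.
  by do 3!eexists; move=> n; apply: (cubic_depressed n size_R).
have M_gt0 : 0 < 3 * c by rewrite mulr_gt0.
have LR_dvd k f n : k * (27 * c ^+ 2 * R.[n]) = f -> ((L * R).[n] %| L.[n] * f)%Z.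
  move=> <-; rewrite hornerM; apply/dvdzP; exists (k * 27 * c ^+ 2); ring.
have M_neq0 := lt0r_neq0 M_gt0.
have [p0|p_neq0] := eqVneq p 0.
  have [q0|q_neq0] := eqVneq q 0.
    apply: (@factorial_dividing_linear_split_cubic _ L (3 * c) X0 1 0 1 0 0) => // n.
    by apply: (LR_dvd 1); rewrite fE p0 q0; ring.
  apply: (@factorial_dividing_linear_cubic _ L p q X0 (3 * c)) => //.
  - by rewrite p0 expr0n mulr0 add0r mulf_neq0 // expf_neq0.
  - by rewrite p0 expr0n mulr0 add0r mulf_neq0 // expf_neq0.
  - by move=> n; apply: (LR_dvd 1); rewrite mul1r fE.
have p2_neq0 : p ^+ 2 != 0 by rewrite expf_neq0.
(* The root is 3 q / p. *)
have [disc0|disc_neq0] := eqVneq (4 * p ^+ 3 + 27 * q ^+ 2) 0.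
  apply: (@factorial_dividing_linear_split_cubic _ L (3 * c) X0 p (- 3 * q)
    (p ^+ 2) (3 * p * q) (p ^+ 3 + 9 * q ^+ 2)) => // n.
  apply: (LR_dvd (p ^+ 3)); rewrite fE; set X := _ + X0.
  apply/eqP; rewrite -subr_eq0; apply/eqP.
  transitivity (q * (4 * p ^+ 3 + 27 * q ^+ 2)); first by ring.
  by rewrite disc0 mulr0.
(* The root is - 9 q / p. *)
have [e0|e_neq0] := eqVneq (8 * p ^+ 3 + 729 * q ^+ 2) 0.
  apply: (@factorial_dividing_linear_split_cubic _ L (3 * c) X0 p (9 * q)
    (p ^+ 2) (- 9 * p * q) (p ^+ 3 + 81 * q ^+ 2)) => // n.
  apply: (LR_dvd (p ^+ 3)); rewrite fE; set X := _ + X0.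
  apply/eqP; rewrite -subr_eq0; apply/eqP.
  transitivity (- q * (8 * p ^+ 3 + 729 * q ^+ 2)); first by ring.
  by rewrite e0 mulr0.
apply: (@factorial_dividing_linear_cubic _ L p q X0 (3 * c)) => // n.
by apply: (LR_dvd 1); rewrite mul1r fE.
Qed.

Theorem theorem3p6 (P : {poly int}) (hdeg : size P = 5%N)
  (hred : reducible_intpoly P) : factorial_dividing P.
Proof.
have [Q [R [size_Q size_R PE]]] := hred.
have size_QR : (size Q + size R = 6)%N.
  have Q_neq0 : Q != 0 by rewrite -size_poly_gt0 ltnW.
  have R_neq0 : R != 0 by rewrite -size_poly_gt0 ltnW.
  have := size_mul Q_neq0 R_neq0; rewrite -PE hdeg => /(congr1 S).
  by rewrite prednK // addn_gt0 ltnW.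
have : [|| size Q == 2, size Q == 3 | size Q == 4]%N.
  by move: (size Q) (size R) size_QR size_Q size_R => i j; clear; lia.
case/or3P=> /eqP size_Q'; rewrite size_Q' in size_QR; case: size_QR => size_R'.
- by rewrite PE; apply: factorial_dividing_linear_mul_cubic.
- by apply: (factorial_dividing_quadratics size_Q' size_R') => n; rewrite PE hornerM.
- by rewrite PE mulrC; apply: factorial_dividing_linear_mul_cubic.
Qed.
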